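(* Let $m,n\in\mathbb{Z}^{+}$, let $X\in\mathbb{R}^{m\times n}$ be a matrix of rank $f\leq\min(m,n)$, and let $r\in\mathbb{Z}^{+}$ with $0<r\leq f$. Let $V_r=[v_1,v_2,\ldots,v_r]\in\mathbb{R}^{n\times r}$, where $v_1,\ldots,v_r$ are the right singular vectors of $X$ corresponding to its largest $r$ singular values, and let $X_r=XV_rV_r^{T}$ be the rank-$r$ approximation of $X$. Suppose that for every rank-$r$ matrix $B_r$ of the form $B_r=X\tilde V_r\tilde V_r^{T}$ with $\tilde V_r\in\mathbb{R}^{n\times r}$, $$\|X-B_r\|_F\geq\|X-X_r\|_F .$$ Then the minimizer $V_*$ of $$\min_{\tilde V\in\mathbb{R}^{n\times r}}\ \|X-X\tilde V\tilde V^{T}\|_F$$ satisfies $V_*V_*^{T}=V_rV_r^{T}$.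
   Context: $\|\cdot\|_F$ denotes the Frobenius norm. The singular value decomposition of the rank-$f$ matrix $X$ is $X=U\Sigma V^{T}$ with $U\in\mathbb{R}^{m\times f}$, $V\in\mathbb{R}^{n\times f}$ having orthonormal columns (left and right singular vectors) and $\Sigma=\mathrm{diag}(\sigma_1,\ldots,\sigma_f)$ the singular values in decreasing order; $v_1,\ldots,v_r$ are the first $r$ columns of $V$. The tail energy of a matrix $B$ with respect to $X$ is $\|X-B\|_F$.
   Formalization: Equality with the given V_rV_r^T is claimed only when σ_r > σ_{r+1} (or r = f), as it fails under ties (X = I_2, r = 1); in general, every minimizer V_* satisfies V_*V_*^T = V'_rV'_r^T for some choice V'_r of right singular vectors for the r largest singular values. *)

(* Defs.v *)
From mathcomp Require Import all_boot all_order all_algebra.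
From mathcomp Require Import reals.
Set Implicit Arguments.
Unset Strict Implicit.
Unset Printing Implicit Defensive.
Import Order.TTheory GRing.Theory Num.Theory.
Local Open Scope ring_scope.

Definition frobenius (R : realType) (m n : nat) (A : 'M[R]_(m, n)) : R :=
  Num.sqrt (\sum_i \sum_j A i j ^+ 2).

Definition tail_energy (R : realType) (m n : nat) (X B : 'M[R]_(m, n)) : R :=
  frobenius (X - B).

(* Thin SVD: the number f of singular triples is the rank of X, so all the
   singular values s are positive.  "Decreasing" allows repeated values. *)
Definition is_svd (R : realType) (m n f : nat) (X : 'M[R]_(m, n))
    (U : 'M[R]_(m, f)) (s : 'rV[R]_f) (V : 'M[R]_(n, f)) : Prop :=
  [/\ X = U *m diag_mx s *m V^T,
      U^T *m U = 1%:M,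
      V^T *m V = 1%:M,
      (forall i, 0 < s 0 i) &
      (forall i j : 'I_f, (i <= j)%N -> s 0 j <= s 0 i)].

Definition first_cols (R : realType) (n f r : nat) (le_rf : (r <= f)%N)
    (V : 'M[R]_(n, f)) : 'M[R]_(n, r) :=
  colsub (widen_ord le_rf) V.

(* sigma_r > sigma_(r+1): exactly the condition under which the span of the
   first r right singular vectors does not depend on the choice of the SVD.
   It holds vacuously when r = f. *)
Definition singular_gap (R : realType) (f r : nat) (s : 'rV[R]_f) : Prop :=
  forall i j : 'I_f, (i < r)%N -> (r <= j)%N -> s 0 j < s 0 i.

(* W ranges over all n x r matrices, with no orthonormality or rank
   constraint. *)
Definition is_minimizer (R : realType) (m n r : nat) (X : 'M[R]_(m, n))
    (Vs : 'M[R]_(n, r)) : Prop :=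
  forall W : 'M[R]_(n, r),
    frobenius (X - X *m Vs *m Vs^T) <= frobenius (X - X *m W *m W^T).

(* Main.v *)
(* Write P = W W^T and let Q be the orthogonal projector onto the column space
   of W.  Then |X - X P|^2 = |X - X Q|^2 + |X (Q - P)|^2, and with
   c_i = v_i^T Q v_i in [0, 1] the first term is sum_i s_i^2 (1 - c_i), where
   sum_i c_i <= tr Q <= r.  Since s is decreasing, this is at least the sum of
   the s_i^2 with i >= r, which is the cost of V_r.  In the equality case Q maps
   into the row space of X, P = Q, and C = V^T Q V is a projector of trace r
   that is the identity where s_i > s_r and zero where s_i < s_r.  Such a C is
   O E O^T, with E the coordinate projector on the first r indices and O an
   orthogonal matrix commuting with diag(s); O rotates (U, V) into the singular
   value decomposition sought, and a gap forces O to commute with E. *)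
Require Import Defs.
From mathcomp Require Import all_boot all_order all_algebra.
From mathcomp Require Import reals.
From mathcomp Require Import ring lra.
Import Order.TTheory GRing.Theory Num.Theory.
Local Open Scope ring_scope.

Set Implicit Arguments.
Unset Strict Implicit.
Unset Printing Implicit Defensive.

(** * Squared Frobenius norms as traces *)

Lemma mxtrace_mul_tr (R : realType) (m n : nat) (A : 'M[R]_(m, n)) :
  \tr (A *m A^T) = \sum_i \sum_j A i j ^+ 2.
Proof.
apply: eq_bigr => i _; rewrite mxE.
by apply: eq_bigr => j _; rewrite mxE expr2.
Qed.

Lemma mxtrace_mul_tr_ge0 (R : realType) (m n : nat) (A : 'M[R]_(m, n)) :
  0 <= \tr (A *m A^T).
Proof.
by rewrite mxtrace_mul_tr; do 2![apply: sumr_ge0 => ? _]; apply: sqr_ge0.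
Qed.

Lemma mxtrace_mul_tr_eq0 (R : realType) (m n : nat) (A : 'M[R]_(m, n)) :
  \tr (A *m A^T) = 0 -> A = 0.
Proof.
rewrite mxtrace_mul_tr => A0; apply/matrixP => i j; rewrite mxE.
have Ai0 : \sum_l A i l ^+ 2 = 0.
  apply: (psumr_eq0P _ A0) => // k _.
  by apply: sumr_ge0 => l _; apply: sqr_ge0.
apply/eqP; rewrite -sqrf_eq0; apply/eqP.
by apply: (psumr_eq0P _ Ai0) => // l _; apply: sqr_ge0.
Qed.

Lemma mul_tr_eq0 (R : realType) (m n : nat) (A : 'M[R]_(m, n)) :
  A *m A^T = 0 -> A = 0.
Proof. by move=> A0; apply: mxtrace_mul_tr_eq0; rewrite A0 mxtrace0. Qed.

Lemma le_frobenius (R : realType) (m n : nat) (A B : 'M[R]_(m, n)) :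
  (frobenius A <= frobenius B) = (\tr (A *m A^T) <= \tr (B *m B^T)).
Proof.
by rewrite /frobenius -!mxtrace_mul_tr ler_sqrt // mxtrace_mul_tr_ge0.
Qed.

(** * Orthogonal projectors and coordinate projectors *)

Definition orthoproj (R : realType) (n : nat) (Q : 'M[R]_n) : Prop :=
  Q^T = Q /\ Q *m Q = Q.

Definition coordproj (R : realType) (n : nat) (J : {set 'I_n}) : 'M[R]_n :=
  diag_mx (\row_i (i \in J)%:R).
Arguments coordproj R {n} J.

Lemma mul_coordproj (R : realType) (n : nat) (J K : {set 'I_n}) :
  coordproj R J *m coordproj R K = coordproj R (J :&: K).
Proof.
rewrite /coordproj mulmx_diag; congr diag_mx; apply/rowP => i.
by rewrite !mxE inE -natrM mulnb.
Qed.

Lemma tr_coordproj (R : realType) (n : nat) (J : {set 'I_n}) :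
  (coordproj R J)^T = coordproj R J.
Proof. exact: tr_diag_mx. Qed.

Lemma mxtrace_coordproj (R : realType) (n : nat) (J : {set 'I_n}) :
  \tr (coordproj R J) = #|J|%:R.
Proof.
rewrite /coordproj mxtrace_diag -sum1_card natr_sum [RHS]big_mkcond /=.
by apply: eq_bigr => i _; rewrite mxE; case: (i \in J).
Qed.

Lemma coordproj0 (R : realType) (n : nat) : coordproj R (set0 : {set 'I_n}) = 0.
Proof. by apply/matrixP => i j; rewrite !mxE inE mul0rn. Qed.

Lemma coordprojT (R : realType) (n : nat) :
  coordproj R [set: 'I_n] = 1%:M.
Proof. by apply/matrixP => i j; rewrite !mxE inE. Qed.

Lemma coordprojU (R : realType) (n : nat) (J K : {set 'I_n}) :
  [disjoint J & K] ->
  coordproj R (J :|: K) = coordproj R J + coordproj R K.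
Proof.
move=> /pred0P dJK; apply/matrixP => i j; rewrite !mxE inE -mulrnDl.
have := dJK i; rewrite /=.
by case: (i \in J); case: (i \in K) => //= _; rewrite ?addr0 ?add0r.
Qed.

Lemma orthoproj_coordproj (R : realType) (n : nat) (J : {set 'I_n}) :
  orthoproj (coordproj R J).
Proof. by split; rewrite ?tr_coordproj // mul_coordproj setIid. Qed.

(** Moves the truncation to [r] columns into a square middle factor, where it can be compared with a
    rotation of [V]. *)
Lemma first_cols_mul_tr (R : realType) (n f r : nat) (le_rf : (r <= f)%N)
    (V : 'M[R]_(n, f)) :
  first_cols le_rf V *m (first_cols le_rf V)^T =
  V *m coordproj R [set i : 'I_f | (i < r)%N] *m V^T.
Proof.
apply/matrixP => i j; rewrite mul_mx_diag !mxE.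
rewrite (eq_bigr (fun k : 'I_r =>
  V i (widen_ord le_rf k) * V j (widen_ord le_rf k))); last first.
  by move=> k _; rewrite !mxE.
rewrite -(big_ord_narrow (F := fun k => V i k * V j k) le_rf) big_mkcond /=.
apply: eq_bigr => k _; rewrite !mxE inE.
by case: (k < r)%N; rewrite ?mulr1 // mulr0 mul0r.
Qed.

Lemma orthoprojC (R : realType) (n : nat) (Q : 'M[R]_n) :
  orthoproj Q -> orthoproj (1%:M - Q).
Proof.
move=> [QT QQ]; split; first by rewrite linearB /= trmx1 QT.
by rewrite mulmxBl mul1mx mulmxBr mulmx1 QQ subrr subr0.
Qed.

(** [Q *m S = S] puts the range of [S] inside that of [Q]; transposing gives [S *m Q = S], and both
    cross terms reduce to [S]. *)
Lemma orthoprojB (R : realType) (n : nat) (Q S : 'M[R]_n) :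
  orthoproj Q -> orthoproj S -> Q *m S = S -> orthoproj (Q - S).
Proof.
move=> [QT QQ] [ST SS] QS; split; first by rewrite linearB /= QT ST.
have SQ : S *m Q = S by rewrite -[S in LHS]ST -[Q]QT -trmx_mul QS ST.
by rewrite mulmxBl !mulmxBr QQ QS SQ SS subrr subr0.
Qed.

(** * The projector onto a column space, and diagonal entries of projectors *)

(** If [K] kills the Gram matrix, then [K *m B] has zero Gram matrix, hence vanishes, and row
    freeness cancels [B]. *)
Lemma row_free_gram_unit (R : realType) (k n : nat) (B : 'M[R]_(k, n)) :
  row_free B -> B *m B^T \in unitmx.
Proof.
move=> freeB; rewrite -row_free_unit -kermx_eq0; apply/eqP.
set K := kermx _; have : K *m (B *m B^T) = 0 by apply: mulmx_ker.
move=> KBB; have : K *m B = 0.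
  by apply: mul_tr_eq0; rewrite trmx_mul mulmxA -(mulmxA K) KBB mul0mx.
by move/eqP; rewrite mulmx_free_eq0 // => /eqP.
Qed.

Lemma orthoproj_colspace (R : realType) (n r : nat) (W : 'M[R]_(n, r)) :
  exists Q : 'M[R]_n, [/\ orthoproj Q, Q *m W = W & \tr Q <= r%:R].
Proof.
have [k le_kr [B freeB eqB]] : exists2 k, (k <= r)%N &
    exists2 B : 'M[R]_(k, n), row_free B & (W^T <= B)%MS.
  exists (\rank W^T); first by rewrite mxrank_tr rank_leq_col.
  by exists (row_base W^T); rewrite ?row_base_free ?eq_row_base.
pose G := B *m B^T; have uG : G \in unitmx by apply: row_free_gram_unit.
have GT : G^T = G by rewrite trmx_mul trmxK.
have GVT : (invmx G)^T = invmx G by rewrite trmx_inv GT.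
(* The usual projector formula, applied to a row basis [B] of [W^T] because [W] may be rank
   deficient. By cyclicity its trace is the number [k] of basis rows. *)
exists (B^T *m invmx G *m B); split.
- split; first by rewrite !trmx_mul trmxK GVT mulmxA.
  by rewrite !mulmxA -(mulmxA _ B B^T) -/G mulmxKV.
- have /submxP[Y WY] := eqB.
  have -> : W = B^T *m Y^T by rewrite -trmx_mul -WY trmxK.
  by rewrite !mulmxA -(mulmxA _ B B^T) -/G mulmxKV.
- by rewrite -mulmxA mxtrace_mulC -mulmxA -/G mulVmx // mxtrace1 ler_nat.
Qed.

(** The entry is the squared norm of [Q] applied to column [i] of [V]. *)
Lemma orthoproj_diag_ge0 (R : realType) (n f : nat) (Q : 'M[R]_n)
    (V : 'M[R]_(n, f)) (i : 'I_f) :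
  orthoproj Q -> 0 <= (V^T *m Q *m V) i i.
Proof.
move=> [QT QQ]; rewrite -QQ -{1}QT mulmxA -trmx_mul -mulmxA mxE.
by apply: sumr_ge0 => j _; rewrite [_^T _ _]mxE -expr2 sqr_ge0.
Qed.

Lemma orthoproj_diag_le1 (R : realType) (n f : nat) (Q : 'M[R]_n)
    (V : 'M[R]_(n, f)) (i : 'I_f) :
  orthoproj Q -> V^T *m V = 1%:M -> (V^T *m Q *m V) i i <= 1.
Proof.
move=> /orthoprojC pQ VV; have := orthoproj_diag_ge0 V i pQ.
by rewrite mulmxBr mulmx1 mulmxBl VV !mxE eqxx subr_ge0.
Qed.

Lemma orthoproj_col_norm (R : realType) (n : nat) (Q : 'M[R]_n) (i : 'I_n) :
  orthoproj Q -> Q i i = \sum_j Q j i ^+ 2.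
Proof.
move=> [QT QQ]; rewrite -{1}QQ -{1}QT mxE.
by apply: eq_bigr => j _; rewrite mxE expr2.
Qed.

(** A diagonal entry of a projector is the squared norm of its column. *)
Lemma orthoproj_diag0 (R : realType) (n : nat) (Q : 'M[R]_n) (i j : 'I_n) :
  orthoproj Q -> Q i i = 0 -> Q j i = 0.
Proof.
move=> pQ; rewrite orthoproj_col_norm // => Qi0.
apply/eqP; rewrite -sqrf_eq0; apply/eqP.
by apply: (psumr_eq0P _ Qi0) => // l _; apply: sqr_ge0.
Qed.

Lemma orthoproj_mul_coordproj0 (R : realType) (n : nat) (Q : 'M[R]_n)
    (J : {set 'I_n}) :
  orthoproj Q -> (forall i, i \in J -> Q i i = 0) -> Q *m coordproj R J = 0.
Proof.
move=> pQ Q0; apply/matrixP => i j; rewrite mul_mx_diag !mxE.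
case: (boolP (j \in J)) => [jJ|_]; last by rewrite mulr0.
by rewrite orthoproj_diag0 ?mul0r ?Q0.
Qed.

Lemma orthoproj_mul_coordproj1 (R : realType) (n : nat) (Q : 'M[R]_n)
    (J : {set 'I_n}) :
  orthoproj Q -> (forall i, i \in J -> Q i i = 1) ->
  Q *m coordproj R J = coordproj R J.
Proof.
move=> pQ Q1; apply/esym/eqP; rewrite -subr_eq0 -{1}[coordproj R J]mul1mx.
rewrite -mulmxBl; apply/eqP; apply: orthoproj_mul_coordproj0.
  exact: orthoprojC.
by move=> i /Q1 Qi; rewrite !mxE Qi eqxx subrr.
Qed.

(** * Factoring projectors through partial isometries *)

(* Peel off the normalized image of a basis vector, and send the chosen index
   of J to it. *)
Lemma orthoproj_isometry (R : realType) (n : nat) (C : 'M[R]_n)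
    (J : {set 'I_n}) :
  orthoproj C -> \tr C = #|J|%:R ->
  exists W : 'M[R]_n, W *m W^T = C /\ W^T *m W = coordproj R J.
Proof.
move: {2}#|J| (erefl #|J|) => k; elim: k => [|k IHk] in C J * => cardJ pC trC.
  exists 0; rewrite trmx0 mulmx0; move/eqP: cardJ; rewrite cards_eq0 => /eqP J0.
  split; last by rewrite J0 coordproj0.
  have [CT CC] := pC; apply/esym/mxtrace_mul_tr_eq0.
  by rewrite CT CC trC J0 cards0.
have [CT CC] := pC.
have [j jJ] : exists j, j \in J by apply/card_gt0P; rewrite cardJ.
have [i Ci_gt0] : exists i, 0 < C i i.
  apply/existsP; rewrite -[X in is_true X]negbK negb_exists.
  apply/negP => /forallP Cle0; have : \tr C <= 0.
    by apply: sumr_le0 => i _; rewrite leNgt.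
  by rewrite trC cardJ lern0.
pose a := Num.sqrt (C i i); have a2 : a ^+ 2 = C i i by rewrite sqr_sqrtr ?ltW.
have a_neq0 : a != 0 by rewrite gt_eqF ?sqrtr_gt0.
(* Column [i] of [C] has squared norm [C i i], which is [a ^+ 2], so [w] is a unit vector in the
   range of [C]. *)
pose w : 'cV[R]_n := a^-1 *: col i C.
have Cw : C *m w = w by rewrite /w -scalemxAr colE mulmxA CC.
have ww : w^T *m w = 1%:M.
  apply/matrixP => x y; rewrite !ord1 !mxE eqxx.
  rewrite (eq_bigr (fun l => a^-1 ^+ 2 * C l i ^+ 2)); last first.
    by move=> l _; rewrite !mxE -exprMn expr2.
  by rewrite -mulr_sumr -orthoproj_col_norm // -a2 -exprMn mulVf // expr1n.
have [] := IHk (C - w *m w^T) (J :\ j).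
- by apply/eqP; rewrite -eqSS -cardJ (cardsD1 j J) jJ.
- apply: orthoprojB => //; last by rewrite mulmxA Cw.
  split; first by rewrite trmx_mul trmxK.
  by rewrite mulmxA -(mulmxA w) ww mulmx1.
- rewrite linearB /= trC mxtrace_mulC ww mxtrace1 (cardsD1 j J) jJ natrD.
  by rewrite addrAC subrr add0r.
move=> W [WWT WTW].
(* [W] kills the basis vector of index [j], which has left the index set, and its range is
   orthogonal to [w], since [w *m w^T] was subtracted from [C]. All cross terms below therefore
   vanish. *)
have Wj : W *m delta_mx j (0 : 'I_1) = 0.
  rewrite -[LHS]trmxK -[RHS]trmx0; congr trmx; apply: mul_tr_eq0.
  rewrite trmxK trmx_mul mulmxA -(mulmxA _ W^T) WTW trmx_delta -mulmxA.
  rewrite -colE -rowE; apply/matrixP => x y; rewrite !ord1 !mxE !inE.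
  by rewrite eqxx mul0rn.
have Ww : w^T *m W = 0.
  apply: mul_tr_eq0; rewrite trmx_mul mulmxA -(mulmxA _ W) WWT trmxK.
  by rewrite mulmxBr mulmxBl -mulmxA Cw mulmxA ww mul1mx ww subrr.
exists (W + w *m delta_mx 0 j).
rewrite linearD /= trmx_mul trmx_delta; split.
  rewrite mulmxDl !mulmxDr !mulmxA Wj mul0mx addr0.
  rewrite -(mulmxA w _ W^T) -[delta_mx 0 j]trmx_delta -trmx_mul.
  rewrite Wj trmx0 mulmx0 add0r WWT trmx_delta -(mulmxA w) mul_delta_mx.
  by rewrite [delta_mx _ _]mx11_scalar mxE eqxx mulmx1 subrK.
rewrite mulmxDl !mulmxDr !mulmxA -(mulmxA _ w^T W) Ww mulmx0 add0r.
have -> : W^T *m w = 0 by rewrite -[LHS]trmxK trmx_mul trmxK Ww trmx0.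
rewrite mul0mx addr0 WTW -(mulmxA _ w^T) ww mulmx1 mul_delta_mx.
have -> : delta_mx j j = coordproj R [set j].
  apply/matrixP => x y; rewrite !mxE inE.
  by have [->|_] := eqVneq x j; rewrite ?mul0rn // eq_sym.
rewrite -coordprojU; first by rewrite setUC setD1K.
by rewrite disjoint_sym disjoints1 !inE eqxx.
Qed.

(** With [E] the coordinate projector, the Gram matrix of [W *m (1%:M - E)] is
    [(1%:M - E) *m E *m (1%:M - E)], which is zero. *)
Lemma mul_coordproj_isometry (R : realType) (n : nat) (W : 'M[R]_n)
    (J : {set 'I_n}) :
  W^T *m W = coordproj R J -> W *m coordproj R J = W.
Proof.
move=> WTW; have [ET EE] := orthoproj_coordproj R J.
have WE' : W *m (1%:M - coordproj R J) = 0.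
  rewrite -[LHS]trmxK -[RHS]trmx0; congr trmx; apply: mul_tr_eq0.
  rewrite trmxK trmx_mul mulmxA -(mulmxA _ W^T) WTW -mulmxA.
  by rewrite mulmxBr mulmx1 EE subrr mulmx0.
by apply/eqP; rewrite eq_sym -subr_eq0 -{1}[W]mulmx1 -mulmxBr WE'.
Qed.

Lemma diag_mul_coordproj (R : realType) (n : nat) (s : 'rV[R]_n) (t : R)
    (J : {set 'I_n}) :
  (forall i, i \in J -> s 0 i = t) ->
  diag_mx s *m coordproj R J = t *: coordproj R J.
Proof.
move=> sJ; apply/matrixP => i j; rewrite mul_diag_mx !mxE.
by have [/sJ->|_] := boolP (i \in J); rewrite ?mul0rn ?mulr0.
Qed.

Lemma coordproj_mul_diag (R : realType) (n : nat) (s : 'rV[R]_n)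
    (J : {set 'I_n}) :
  coordproj R J *m diag_mx s = diag_mx s *m coordproj R J.
Proof. exact: diag_mxC. Qed.

(* C is the identity where s > t and zero where s < t; the rest lives in the
   eigenspace of diag_mx s for t, where any isometry commutes with diag_mx s. *)
Lemma orthoproj_isometry_comm (R : realType) (f : nat) (C : 'M[R]_f)
    (s : 'rV[R]_f) (t : R) (L : {set 'I_f}) :
  orthoproj C -> \tr C = #|L|%:R ->
  (forall i, t < s 0 i -> C i i = 1 /\ i \in L) ->
  (forall i, s 0 i < t -> C i i = 0 /\ i \notin L) ->
  exists Y : 'M[R]_f,
    [/\ Y *m Y^T = C, Y^T *m Y = coordproj R L &
        Y *m diag_mx s = diag_mx s *m Y].
Proof.
move=> pC trC C1 C0; have [CT CC] := pC.
pose A := [set i | t < s 0 i]; pose B := [set i | s 0 i < t].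
pose M := [set i | s 0 i == t].
have pA := orthoproj_coordproj R A; have [AT AA] := pA.
have [BT _] := orthoproj_coordproj R B.
have CA : C *m coordproj R A = coordproj R A.
  by apply: orthoproj_mul_coordproj1 => // i; rewrite inE => /C1[].
have AC : coordproj R A *m C = coordproj R A.
  by rewrite -[LHS]trmxK trmx_mul CT AT CA AT.
have BC : coordproj R B *m C = 0.
  rewrite -[LHS]trmxK trmx_mul CT BT orthoproj_mul_coordproj0 ?trmx0 //.
  by move=> i; rewrite inE => /C0[].
have sAL : A \subset L by apply/subsetP => i; rewrite inE => /C1[].
pose J := L :\: A.
(* On [A] the identity serves as isometry; what remains of [C] is a projector of trace
   [#|L| - #|A|]. *)
have [W [WWT WTW]] : exists W : 'M[R]_f,
    W *m W^T = C - coordproj R A /\ W^T *m W = coordproj R J.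
  apply: orthoproj_isometry; first exact: orthoprojB.
  rewrite linearB /= trC mxtrace_coordproj cardsD (setIidPr sAL).
  by rewrite natrB ?subset_leq_card.
have WJ : W *m coordproj R J = W by apply: mul_coordproj_isometry.
have CW : (C - coordproj R A) *m W = W by rewrite -WWT -mulmxA WTW.
have AW : coordproj R A *m W = 0.
  by rewrite -CW mulmxA mulmxBr AC AA subrr mul0mx.
have WA : W *m coordproj R A = 0.
  rewrite -WJ -mulmxA mul_coordproj setIDAC setDIl setDv setI0.
  by rewrite coordproj0 mulmx0.
have BW : coordproj R B *m W = 0.
  by rewrite -CW mulmxBl AW subr0 mulmxA BC mul0mx.
(* [A], [B] and [M] partition the indices, and the range of [W] has no component along [A] or
   [B]. *)
have MW : coordproj R M *m W = W.
  have : (coordproj R A + coordproj R B + coordproj R M) *m W = W.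
    rewrite -!coordprojU.
    - suff -> : A :|: B :|: M = setT by rewrite coordprojT mul1mx.
      by apply/setP => i; rewrite !inE; case: ltgtP.
    - by apply/pred0P => i /=; rewrite !inE; case: ltgtP.
    - by apply/pred0P => i /=; rewrite !inE; case: ltgtP.
  by rewrite !mulmxDl AW BW !add0r.
have sW : diag_mx s *m W = t *: W.
  rewrite -MW mulmxA (diag_mul_coordproj (t := t)) ?scalemxAl //.
  by move=> i; rewrite inE => /eqP.
(* On the source side, an index of [J] is outside [A], so [s <= t], and inside [L], so not
   [s < t]. *)
have Ws : W *m diag_mx s = t *: W.
  rewrite -WJ -mulmxA coordproj_mul_diag (diag_mul_coordproj (t := t)).
    by rewrite scalemxAr.
  move=> i; rewrite !inE -leNgt => /andP[le_st iL]; apply/eqP.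
  rewrite eq_le le_st leNgt; apply/negP => /C0[_].
  by rewrite iL.
have YT : (coordproj R A + W)^T = coordproj R A + W^T by rewrite linearD /= AT.
exists (coordproj R A + W); split.
- rewrite YT mulmxDl !mulmxDr WWT AA WA add0r.
  by rewrite -[_ *m W^T]trmxK trmx_mul trmxK AT WA trmx0 addr0 addrC subrK.
- rewrite YT mulmxDl !mulmxDr AW addr0 AA WTW.
  rewrite -[W^T *m _]trmxK trmx_mul trmxK AT AW trmx0 add0r -coordprojU.
    by rewrite -{1}(setIidPr sAL) setID.
  rewrite disjoint_sym disjoints_subset.
  by apply/subsetP => i; rewrite !inE => /andP[].
- by rewrite mulmxDl mulmxDr coordproj_mul_diag sW Ws.
Qed.

(** Isometries for [C] and for its complement have orthogonal ranges and complementary sources, so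
    their sum is orthogonal. *)
Lemma orthoproj_conj_coordproj (R : realType) (f : nat) (C : 'M[R]_f)
    (s : 'rV[R]_f) (t : R) (L : {set 'I_f}) :
  orthoproj C -> \tr C = #|L|%:R ->
  (forall i, t < s 0 i -> C i i = 1 /\ i \in L) ->
  (forall i, s 0 i < t -> C i i = 0 /\ i \notin L) ->
  exists O : 'M[R]_f,
    [/\ O^T *m O = 1%:M, O *m diag_mx s = diag_mx s *m O &
        C = O *m coordproj R L *m O^T].
Proof.
move=> pC trC C1 C0; have [CT CC] := pC.
have [Y [YY YTY Ys]] := orthoproj_isometry_comm pC trC C1 C0.
(* Negating [s] and [t] exchanges the two strict inequalities, as passing to [1%:M - C] and [~: L]
   exchanges the two conclusions. *)
have [||i|i|Z [ZZ ZTZ Zs]] :=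
    @orthoproj_isometry_comm R f (1%:M - C) (- s) (- t) (~: L).
- exact: orthoprojC.
- rewrite linearB /= trC mxtrace1 -{1}(card_ord f) -(cardsC L) natrD.
  by rewrite addrAC subrr add0r.
- by rewrite !mxE eqxx ltrN2 inE => /C0[-> ->]; rewrite subr0.
- by rewrite !mxE eqxx ltrN2 inE => /C1[-> ->]; rewrite subrr.
have YL := mul_coordproj_isometry YTY.
have ZL := mul_coordproj_isometry ZTZ.
have ZL0 : Z *m coordproj R L = 0.
  by rewrite -ZL -mulmxA mul_coordproj setIC setICr coordproj0 mulmx0.
have CY : C *m Y = Y by rewrite -YY -mulmxA YTY.
have CZ : C *m Z = 0.
  have <- : (1%:M - C) *m Z = Z by rewrite -ZZ -mulmxA ZTZ.
  by rewrite mulmxA mulmxBr mulmx1 CC subrr mul0mx.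
have YZ : Y^T *m Z = 0 by rewrite -CY trmx_mul CT -mulmxA CZ mulmx0.
have ZY : Z^T *m Y = 0 by rewrite -[LHS]trmxK trmx_mul trmxK YZ trmx0.
have OT : (Y + Z)^T = Y^T + Z^T by rewrite linearD.
exists (Y + Z); rewrite OT; split.
- rewrite mulmxDl !mulmxDr YZ ZY YTY ZTZ addr0 add0r -coordprojU.
    by rewrite setUCr coordprojT.
  by rewrite disjoints_subset setCK.
- rewrite mulmxDl mulmxDr Ys; congr (_ + _).
  move: Zs; have -> : diag_mx (- s) = - diag_mx s by rewrite linearN.
  by rewrite mulmxN mulNmx => /oppr_inj.
- rewrite mulmxDl ZL0 addr0 YL mulmxDr YY.
  by rewrite -YL -mulmxA -tr_coordproj -trmx_mul ZL0 trmx0 mulmx0 addr0.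
Qed.

(** * Residuals and the Eckart-Young bound with its equality case *)

Lemma mxtrace_pythagoras (R : realType) (m n : nat) (A B : 'M[R]_(m, n)) :
  A *m B^T = 0 ->
  \tr ((A + B) *m (A + B)^T) = \tr (A *m A^T) + \tr (B *m B^T).
Proof.
move=> AB; have BA : B *m A^T = 0.
  by rewrite -[LHS]trmxK trmx_mul trmxK AB trmx0.
have -> : (A + B)^T = A^T + B^T by rewrite linearD.
by rewrite mulmxDl !mulmxDr AB BA addr0 add0r linearD.
Qed.

(** The Gram matrix of the residual is [X *m (1%:M - Q) *m X^T]; cyclicity of the trace cancels [U]
    and leaves the diagonal of [V^T *m (1%:M - Q) *m V] weighted by the squares of [s]. *)
Lemma residual_orthoproj (R : realType) (m n f : nat) (X : 'M[R]_(m, n))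
    (U : 'M[R]_(m, f)) (s : 'rV[R]_f) (V : 'M[R]_(n, f)) (Q : 'M[R]_n) :
  is_svd X U s V -> orthoproj Q ->
  \tr ((X - X *m Q) *m (X - X *m Q)^T) =
  \sum_i s 0 i ^+ 2 * (1 - (V^T *m Q *m V) i i).
Proof.
move=> [XE UU VV _ _] /orthoprojC[QT' QQ'].
pose K := V^T *m (1%:M - Q) *m V.
have -> : X - X *m Q = X *m (1%:M - Q) by rewrite mulmxBr mulmx1.
rewrite trmx_mul QT' mulmxA -(mulmxA X) QQ'.
have -> : X *m (1%:M - Q) *m X^T =
    U *m (diag_mx s *m K *m diag_mx s *m U^T).
  by rewrite {1 2}XE !trmx_mul trmxK tr_diag_mx !mulmxA.
rewrite mxtrace_mulC -(mulmxA _ U^T) UU mulmx1.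
have Ki i : K i i = 1 - (V^T *m Q *m V) i i.
  by rewrite /K mulmxBr mulmxBl mulmx1 VV !mxE eqxx.
apply: eq_bigr => i _; rewrite -Ki; move: K {Ki} => K.
rewrite mul_mx_diag mul_diag_mx !mxE.
by ring.
Qed.

(** The rows of [D] lie in the range of [Q], those of [X - X *m Q] in its orthogonal complement. *)
Lemma residual_split (R : realType) (m n r : nat) (X : 'M[R]_(m, n))
    (W : 'M[R]_(n, r)) (Q : 'M[R]_n) :
  orthoproj Q -> Q *m W = W ->
  let E := X - X *m W *m W^T in
  let D := X *m Q - X *m W *m W^T in
  \tr (E *m E^T) =
  \tr ((X - X *m Q) *m (X - X *m Q)^T) + \tr (D *m D^T).
Proof.
move=> [QT QQ] QW E D.
rewrite -mxtrace_pythagoras; first by rewrite /E /D addrA subrK.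
have WQ : W^T *m Q = W^T by rewrite -{1}QT -trmx_mul QW.
have -> : D = D *m Q by rewrite /D mulmxBl -!mulmxA QQ WQ.
by rewrite trmx_mul QT mulmxA mulmxBl -mulmxA QQ subrr mul0mx.
Qed.

(* The excess equals
   [\sum_i (a i - t) * ((i \in L) - c i) + t * (#|L| - \sum_i c i)]. *)
Lemma fractional_selection (R : realType) (f : nat) (a c : 'I_f -> R)
    (L : {set 'I_f}) (t : R) :
  0 < t -> (forall i, i \in L -> t <= a i) ->
  (forall i, i \notin L -> a i <= t) ->
  (forall i, 0 <= c i <= 1) -> \sum_i c i <= #|L|%:R ->
  \sum_i a i * (1 - (i \in L)%:R) <= \sum_i a i * (1 - c i) /\
  (\sum_i a i * (1 - c i) <= \sum_i a i * (1 - (i \in L)%:R) ->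
   \sum_i c i = #|L|%:R /\
   (forall i, (a i - t) * ((i \in L)%:R - c i) = 0)).
Proof.
move=> t_gt0 aL aL' c01 sumc.
have cardL : #|L|%:R = \sum_i (i \in L)%:R :> R.
  rewrite -mxtrace_coordproj mxtrace_diag.
  by apply: eq_bigr => i _; rewrite mxE.
have excess : \sum_i a i * (1 - c i) - \sum_i a i * (1 - (i \in L)%:R) =
    \sum_i (a i - t) * ((i \in L)%:R - c i) + t * (#|L|%:R - \sum_i c i).
  rewrite cardL -!sumrB mulr_sumr -big_split /=.
  by apply: eq_bigr => i _; ring.
have term_ge0 i : true -> 0 <= (a i - t) * ((i \in L)%:R - c i).
  move=> _; have /andP[c0 c1] := c01 i.
  have [/aL|/aL'] := boolP (i \in L) => ai.
    by rewrite mulr_ge0 ?subr_ge0.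
  by rewrite mulr_le0 ?subr_le0.
have sum_ge0 := sumr_ge0 _ term_ge0.
have rest_ge0 : 0 <= t * (#|L|%:R - \sum_i c i).
  by rewrite mulr_ge0 ?subr_ge0 // ltW.
split; first by rewrite -subr_ge0 excess addr_ge0.
rewrite -subr_le0 excess => le0.
have sum0 : \sum_i (a i - t) * ((i \in L)%:R - c i) = 0.
  by apply/eqP; rewrite eq_le sum_ge0 andbT; lra.
have rest0 : t * (#|L|%:R - \sum_i c i) = 0.
  by apply/eqP; rewrite eq_le rest_ge0 andbT; lra.
split; last by move=> i; apply: (psumr_eq0P term_ge0 sum0).
by move/eqP: rest0; rewrite mulf_eq0 gt_eqF //= subr_eq0 => /eqP.
Qed.

Lemma card_ord_lt (f r : nat) : (r <= f)%N -> #|[set i : 'I_f | (i < r)%N]| = r.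
Proof.
move=> le_rf; rewrite cardsE -sum1_card.
by rewrite (big_ord_narrow (F := fun=> 1%N) le_rf) sum1_card card_ord.
Qed.

Lemma tr_first_cols_mul (R : realType) (n f r : nat) (le_rf : (r <= f)%N)
    (V : 'M[R]_(n, f)) :
  V^T *m V = 1%:M -> (first_cols le_rf V)^T *m first_cols le_rf V = 1%:M.
Proof.
move=> VV; apply/matrixP => i j.
have := congr1 (fun A : 'M_f => A (widen_ord le_rf i) (widen_ord le_rf j)) VV.
rewrite !mxE => VVij; rewrite -[RHS]VVij.
by apply: eq_bigr => k _; rewrite !mxE.
Qed.

Lemma orthoproj_mul_tr (R : realType) (n r : nat) (W : 'M[R]_(n, r)) :
  W^T *m W = 1%:M -> orthoproj (W *m W^T).
Proof.
move=> WW; split; first by rewrite trmx_mul trmxK.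
by rewrite mulmxA -(mulmxA W) WW mulmx1.
Qed.

Lemma residual_first_cols (R : realType) (m n f r : nat) (le_rf : (r <= f)%N)
    (X : 'M[R]_(m, n)) (U : 'M[R]_(m, f)) (s : 'rV[R]_f) (V : 'M[R]_(n, f)) :
  is_svd X U s V ->
  let Vr := first_cols le_rf V in
  let E := X - X *m Vr *m Vr^T in
  \tr (E *m E^T) =
  \sum_i s 0 i ^+ 2 * (1 - (i \in [set i : 'I_f | (i < r)%N])%:R).
Proof.
move=> svdX Vr E; have [_ _ VV _ _] := svdX.
have pV := orthoproj_mul_tr (tr_first_cols_mul le_rf VV).
rewrite /E -mulmxA (residual_orthoproj svdX pV).
apply: eq_bigr => i _; congr (_ * (1 - _)).
rewrite first_cols_mul_tr !mulmxA VV mul1mx -mulmxA VV mulmx1.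
by rewrite !mxE eqxx mulr1n.
Qed.

(** The difference of the traces is the squared Frobenius norm of [Q *m (1%:M - V *m V^T)], whose
    vanishing is the equality case. *)
Lemma le_mxtrace_compress (R : realType) (n f : nat) (Q : 'M[R]_n)
    (V : 'M[R]_(n, f)) :
  orthoproj Q -> V^T *m V = 1%:M ->
  \tr (V^T *m Q *m V) <= \tr Q /\
  (\tr Q <= \tr (V^T *m Q *m V) -> Q *m V *m V^T = Q).
Proof.
move=> [QT QQ] VV; pose N := 1%:M - V *m V^T.
have [NT NN] : orthoproj N by apply: orthoprojC; apply: orthoproj_mul_tr.
have QN : Q *m N = Q - Q *m V *m V^T by rewrite mulmxBr mulmx1 mulmxA.
have defect : \tr (Q *m N *m (Q *m N)^T) = \tr Q - \tr (V^T *m Q *m V).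
  rewrite trmx_mul QT NT mulmxA -(mulmxA Q) NN mxtrace_mulC mulmxA QQ QN.
  by rewrite linearB /= mxtrace_mulC mulmxA.
have defect_ge0 := mxtrace_mul_tr_ge0 (Q *m N).
split; first by rewrite -subr_ge0 -defect.
rewrite -subr_le0 -defect => defect_le0.
have /mxtrace_mul_tr_eq0/eqP : \tr (Q *m N *m (Q *m N)^T) = 0.
  by apply/eqP; rewrite eq_le defect_le0.
by rewrite QN subr_eq0 => /eqP.
Qed.

Lemma eckart_young_proj (R : realType) (m n f r : nat) (X : 'M[R]_(m, n))
    (U : 'M[R]_(m, f)) (s : 'rV[R]_f) (V : 'M[R]_(n, f)) (W : 'M[R]_(n, r)) :
  is_svd X U s V -> (0 < r)%N -> (r <= f)%N ->
  let E := X - X *m W *m W^T in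
  let L := [set i : 'I_f | (i < r)%N] in
  let best := \sum_i s 0 i ^+ 2 * (1 - (i \in L)%:R) in
  best <= \tr (E *m E^T) /\
  (\tr (E *m E^T) <= best ->
   exists O : 'M[R]_f,
    [/\ O^T *m O = 1%:M, O *m diag_mx s = diag_mx s *m O &
        W *m W^T = V *m O *m coordproj R L *m (V *m O)^T]).
Proof.
move=> svdX r_gt0 le_rf E L best; have [XE UU VV s_gt0 s_decr] := svdX.
have [Q [pQ QW trQ]] := orthoproj_colspace W; have [QT QQ] := pQ.
pose C := V^T *m Q *m V.
have [le_trC trC_eq] := le_mxtrace_compress pQ VV.
(* Indices start at 0, so [t] is the [r]-th largest singular value; [0 < r] makes the predecessor
   genuine. *)
have lt_r1f : (r.-1 < f)%N by rewrite prednK.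
pose t := s 0 (Ordinal lt_r1f).
have s_ge0 i : 0 <= s 0 i by rewrite ltW.
have t_ge0 : 0 <= t by apply: s_ge0.
have sL i : i \in L -> t <= s 0 i.
  by rewrite inE => lt_ir; apply: s_decr; rewrite /= -ltnS prednK.
have sL' i : i \notin L -> s 0 i <= t.
  rewrite inE -leqNgt => le_ri; apply: s_decr.
  by rewrite /= (leq_trans (leq_pred r)).
have cardL : #|L| = r by apply: card_ord_lt.
have [|||||le_best eq_best] := @fractional_selection R f
    (fun i => s 0 i ^+ 2) (fun i => C i i) L (t ^+ 2).
- by rewrite exprn_gt0 // s_gt0.
- by move=> i /sL; rewrite ler_sqr ?nnegrE ?s_ge0.
- by move=> i /sL'; rewrite ler_sqr ?nnegrE ?s_ge0.
- by move=> i; rewrite orthoproj_diag_ge0 // orthoproj_diag_le1.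
- by rewrite cardL; apply: le_trans le_trC trQ.
rewrite (residual_split X pQ QW) (residual_orthoproj svdX pQ).
set D := X *m Q - _; have D_ge0 := mxtrace_mul_tr_ge0 D.
split; first by rewrite (le_trans le_best) // lerDl.
(* Tightness closes the whole chain of inequalities: the selection bound is attained and the extra
   term in [D] is zero. *)
move=> tight; have [|trC diagC] := eq_best.
  by apply: le_trans tight; rewrite lerDl.
have /mxtrace_mul_tr_eq0/eqP : \tr (D *m D^T) = 0.
  apply/eqP; rewrite eq_le D_ge0 andbT.
  by have := le_trans tight le_best; rewrite gerDl.
rewrite subr_eq0 => /eqP XQ.
(* Here [\tr C = r] while [\tr Q <= r], so compressing by [V] loses no trace. *)
have QM : Q *m V *m V^T = Q by apply: trC_eq; rewrite [X in _ <= X]trC cardL.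
have MQ : V *m V^T *m Q = Q.
  rewrite -[LHS]trmxK trmx_mul QT [(V *m V^T)^T]trmx_mul trmxK mulmxA.
  by rewrite QM.
have uS : diag_mx s \in unitmx.
  rewrite unitmxE det_diag unitfE; apply/prodf_neq0 => i _.
  by rewrite gt_eqF.
have VX : V^T = invmx (diag_mx s) *m U^T *m X.
  by rewrite XE !mulmxA -(mulmxA _ U^T) UU mulmx1 mulVmx // mul1mx.
(* Cancelling [U] and the singular values in [XQ] leaves an equality after left multiplication by
   [V^T]. Both ranges lie in that of [V], so multiplying by [V] recovers the matrices. *)
have WW : W *m W^T = Q.
  have VQ : V^T *m Q = V^T *m (W *m W^T).
    by rewrite VX -!mulmxA XQ !mulmxA.
  have QWW : Q *m (W *m W^T) = W *m W^T by rewrite mulmxA QW.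
  have MWW : V *m V^T *m (W *m W^T) = W *m W^T by rewrite -QWW mulmxA MQ.
  by rewrite -MWW -mulmxA -VQ mulmxA MQ.
have pC : orthoproj C.
  split; first by rewrite /C !trmx_mul trmxK QT mulmxA.
  by rewrite /C -!mulmxA (mulmxA V V^T) (mulmxA _ Q V) MQ (mulmxA Q Q) QQ.
have sqr_s_eq i : s 0 i ^+ 2 - t ^+ 2 = 0 -> s 0 i = t.
  by move=> /subr0_eq/eqP; rewrite eqrXn2 // => /eqP.
(* Complementary slackness: only indices tied with [t] may carry a fractional weight. *)
have diagC' i : s 0 i != t -> C i i = (i \in L)%:R.
  move=> neq_st; have /eqP := diagC i; rewrite mulf_eq0.
  case/orP=> /eqP; last by move/subr0_eq.
  by move/sqr_s_eq/eqP; rewrite (negPf neq_st).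
have [|i lt_ts|i lt_st|O [OO OS CO]] :=
    @orthoproj_conj_coordproj R f C s t L pC.
- exact: trC.
- have iL : i \in L by apply: contraTT lt_ts => /sL'; rewrite -leNgt.
  by rewrite diagC' ?iL // gt_eqF.
- have iL : i \notin L by apply: contraTN lt_st => /sL; rewrite -leNgt.
  by rewrite diagC' ?(negPf iL) // lt_eqF.
exists O; split=> //; rewrite WW trmx_mul.
have -> : Q = V *m C *m V^T by rewrite /C !mulmxA MQ QM.
by rewrite CO !mulmxA.
Qed.

(** * Rotations of the singular value decomposition *)

Lemma is_svd_rotate (R : realType) (m n f : nat) (X : 'M[R]_(m, n))
    (U : 'M[R]_(m, f)) (s : 'rV[R]_f) (V : 'M[R]_(n, f)) (O : 'M[R]_f) :
  is_svd X U s V -> O^T *m O = 1%:M -> O *m diag_mx s = diag_mx s *m O ->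
  is_svd X (U *m O) s (V *m O).
Proof.
move=> [XE UU VV s_gt0 s_decr] OO OS; have OO' := mulmx1C OO.
split=> //; rewrite ?trmx_mul.
- rewrite -(mulmxA U) OS mulmxA -(mulmxA _ O) (mulmxA O) OO' mul1mx.
  exact: XE.
- by rewrite mulmxA -(mulmxA _ U^T) UU mulmx1.
- by rewrite mulmxA -(mulmxA _ V^T) VV mulmx1.
Qed.

(** Entrywise, commutation says that [O i j] vanishes unless [s] agrees at [i] and [j]; the gap then
    kills both off-diagonal blocks. *)
Lemma comm_coordproj_gap (R : realType) (f r : nat) (s : 'rV[R]_f)
    (O : 'M[R]_f) :
  singular_gap r s -> O *m diag_mx s = diag_mx s *m O ->
  let E := coordproj R [set i : 'I_f | (i < r)%N] in O *m E = E *m O.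
Proof.
move=> gap OS; apply/matrixP => i j.
have := congr1 (fun A : 'M_f => A i j) OS; rewrite /=.
rewrite !(mul_mx_diag, mul_diag_mx) !mxE !inE => Oij.
have Oij0 : s 0 i != s 0 j -> O i j = 0.
  move=> neq; apply/eqP; have /eqP := Oij.
  rewrite mulrC -subr_eq0 -mulrBl mulf_eq0 subr_eq0 eq_sym.
  by rewrite (negPf neq).
case: (ltnP i r) => i_r; case: (ltnP j r) => j_r;
  rewrite ?mulr1 ?mul1r ?mulr0 ?mul0r //.
  by rewrite Oij0 // gt_eqF // gap.
by rewrite Oij0 // lt_eqF // gap.
Qed.

Unset Implicit Arguments.
Set Printing Implicit Defensive.

Theorem theorem2 (R : realType) (m n f r : nat)
    (m_gt0 : (0 < m)%N) (n_gt0 : (0 < n)%N)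
    (X : 'M[R]_(m, n)) (rankX : \rank X = f) (le_f : (f <= minn m n)%N)
    (r_gt0 : (0 < r)%N) (le_rf : (r <= f)%N)
    (U : 'M[R]_(m, f)) (s : 'rV[R]_f) (V : 'M[R]_(n, f))
    (svdX : is_svd X U s V) :
  let Vr := first_cols le_rf V in
  let Xr := X *m Vr *m Vr^T in
  (forall (Br : 'M[R]_(m, n)) (W : 'M[R]_(n, r)),
     \rank Br = r -> Br = X *m W *m W^T ->
     tail_energy X Xr <= tail_energy X Br) ->
  (exists Vs : 'M[R]_(n, r), is_minimizer X Vs) /\
  (forall Vs : 'M[R]_(n, r), is_minimizer X Vs ->
     (singular_gap r s -> Vs *m Vs^T = Vr *m Vr^T) /\
     (exists (U' : 'M[R]_(m, f)) (V' : 'M[R]_(n, f)),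
        is_svd X U' s V' /\
        Vs *m Vs^T = first_cols le_rf V' *m (first_cols le_rf V')^T)).
Proof.
move=> Vr Xr _; have [_ _ VV _ _] := svdX.
have resVr := residual_first_cols le_rf svdX.
split.
  exists Vr => W; rewrite le_frobenius resVr.
  by have [] := eckart_young_proj W svdX r_gt0 le_rf.
(* Testing minimality against [Vr], which attains the lower bound, puts [Vs] in the equality
   case. *)
move=> Vs /(_ Vr); rewrite le_frobenius resVr => minVs.
have [_ /(_ minVs)[O [OO OS VsO]]] := eckart_young_proj Vs svdX r_gt0 le_rf.
split; last first.
  exists (U *m O), (V *m O); split; first exact: is_svd_rotate.
  by rewrite first_cols_mul_tr.
(* Once [O] commutes with the coordinate projector, it meets [O^T] and cancels. *)
move=> /comm_coordproj_gap/(_ OS) OE.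
rewrite VsO first_cols_mul_tr -(mulmxA V) OE trmx_mul !mulmxA.
by rewrite -(mulmxA _ O O^T) (mulmx1C OO) mulmx1.
Qed.
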